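(* Let $X,Y$ be real Hausdorff locally convex topological vector spaces, $\varphi:X\times Y\to\overline{\mathbb R}$ a function and $G:X\rightrightarrows Y$ a set-valued map. Let $\mu(x)=\inf\{\varphi(x,y)\mid y\in G(x)\}$ and $M(x)=\{y\in G(x)\mid\mu(x)=\varphi(x,y)\}$ for $x\in X$. Suppose that at least one of the following conditions is satisfied: (i) $\varphi$ is proper polyhedral convex and $G$ is generalized polyhedral convex; (ii) $\varphi$ is proper generalized polyhedral convex and $G$ is polyhedral convex. Then, for any $\bar x\in X$ with $\mu(\bar x)\in\mathbb R$ and for any $\bar y\in M(\bar x)$, one has $$\partial^\infty\mu(\bar x)=A_0^\infty=A^\infty=B_0^\infty=B^\infty,$$ where $$A_0^\infty=\bigcup_{(x^*,y^* )\in\partial^\infty\varphi(\bar x,\bar y)}\{x^*+D^*G(\bar x,\bar y)(y^* )\},\qquad A^\infty=\overline{A_0^\infty},$$ $$B_0^\infty=\mathrm{pr}_{X^*}\Big[\big(\partial^\infty\varphi(\bar x,\bar y)+N((\bar x,\bar y);\mathrm{gph}\,G)\big)\cap(X^*\times\{0\})\Big],$$ $$B^\infty=\mathrm{pr}_{X^*}\Big[\overline{\partial^\infty\varphi(\bar x,\bar y)+N((\bar x,\bar y);\mathrm{gph}\,G)}\cap(X^*\times\{0\})\Big].$$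
   Context: $\overline{\mathbb R}=\mathbb R\cup\{\pm\infty\}$, $\inf\emptyset=+\infty$. Dual spaces $X^*$, $Y^*$ carry the weak$^*$ topology, $(X\times Y)^*$ is identified with $X^*\times Y^*$, and an overline over a subset of a dual space is the weak$^*$ closure. $\mathrm{pr}_{X^*}:X^*\times Y^*\to X^*$, $(x^*,y^* )\mapsto x^*$. A function $f:Z\to\overline{\mathbb R}$ is proper if $\mathrm{dom}\,f=\{z\mid f(z)<+\infty\}\ne\emptyset$ and $f(z)\neq-\infty$ for all $z$; $\mathrm{epi}\,f=\{(z,\lambda)\in Z\times\mathbb R\mid f(z)\le\lambda\}$; $f$ is convex if $\mathrm{epi}\,f$ is convex. For a set-valued map, $\mathrm{gph}\,G=\{(x,y)\mid y\in G(x)\}$. A subset $D$ of a real Hausdorff locally convex space $Z$ is a generalized polyhedral convex set if $D=\{z\in L\mid \langle z_i^*,z\rangle\le\alpha_i,\ i=1,\dots,p\}$ for some $z_i^*\in Z^*$, $\alpha_i\in\mathbb R$, and some closed affine subspace $L\subset Z$; it is a polyhedral convex set if it has such a representation with $L=Z$. A function (resp. set-valued map) is (generalized) polyhedral convex if its epigraph (resp. its graph) is a (generalized) polyhedral convex set. Normal cone to a convex set $C$: $N(\bar z;C)=\{z^*\mid\langle z^*,z-\bar z\rangle\le0\ \forall z\in C\}$ if $\bar z\in C$, and $\emptyset$ otherwise. For convex $f$ with $f(\bar z)\in\mathbb R$: $\partial^\infty f(\bar z)=\{z^*\mid(z^*,0)\in N((\bar z,f(\bar z));\mathrm{epi}\,f)\}$;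 it is $\emptyset$ if $f(\bar z)\notin\mathbb R$. Coderivative of a convex set-valued map $G$ (one with convex graph) at $(\bar x,\bar y)\in\mathrm{gph}\,G$: $D^*G(\bar x,\bar y)(y^* )=\{x^*\in X^*\mid(x^*,-y^* )\in N((\bar x,\bar y);\mathrm{gph}\,G)\}$ for $y^*\in Y^*$. Under the stated assumptions $\mu$ is a convex function. *)

(* Defs.v *)
From HB Require Import structures.
From mathcomp Require Import all_boot all_order all_algebra.
From mathcomp Require Import all_classical all_reals all_analysis.

Set Implicit Arguments.
Unset Strict Implicit.
Unset Printing Implicit Defensive.

Import Order.TTheory GRing.Theory Num.Theory.
Import numFieldNormedType.Exports.

Local Open Scope classical_set_scope.
Local Open Scope ring_scope.

(** A locally convex space is a [tvsType R]; the Hausdorff property is a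
    separate hypothesis, [hausdorff_space]. *)

Section topological_dual.
Context (R : realType) (Z : tvsType R).

Definition topdual_pred : {pred Z -> R^o} :=
  mem [set f : Z -> R^o | linear f /\ continuous f].

Record topdual := TopDual {
  topdual_fun :> Z -> R^o ;
  topdual_funP : topdual_fun \in topdual_pred }.

HB.instance Definition _ := [isSub for topdual_fun].
HB.instance Definition _ := [Choice of topdual by <:].

Lemma topdual_submod_closed : submod_closed topdual_pred.
Proof.
split.
  rewrite inE; split; last by move=> x; exact: cvg_cst.
  by move=> a u v /=; rewrite scaler0 addr0.
move=> a f g; rewrite !inE => -[lf cf] [lg cg]; split.
  move=> b u v /=; rewrite !fctE lf lg !scalerDr !scalerA [a * b]mulrC.
  by rewrite addrACA.
move=> x; apply: (@cvgD _ R^o); last exact: cg.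
by apply: (@cvgZl_tmp R R^o); exact: cf.
Qed.

HB.instance Definition _ :=
  GRing.isSubmodClosed.Build R (Z -> R^o) topdual_pred topdual_submod_closed.
HB.instance Definition _ := [SubChoice_isSubLmodule of topdual by <:].

(** Weak-star topology: the topology of pointwise convergence on [Z]. *)
HB.instance Definition _ := Topological.copy topdual
  (initial_topology (topdual_fun : topdual -> {ptws Z -> R^o})).

Lemma topdual_linear (f : topdual) : linear f.
Proof. by have := topdual_funP f; rewrite inE => -[]. Qed.

Lemma topdual_continuous (f : topdual) : continuous f.
Proof. by have := topdual_funP f; rewrite inE => -[]. Qed.

End topological_dual.

(** The identification of [X^* * Y^*] with [(X * Y)^*]. *)
Section dual_of_product.
Context (R : realType) (X Y : tvsType R).

Definition pair_fun (f : topdual X) (g : topdual Y) : X * Y -> R^o :=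
  fun z => f z.1 + g z.2.

Lemma pair_funP (f : topdual X) (g : topdual Y) :
  pair_fun f g \in @topdual_pred R (X * Y)%type.
Proof.
rewrite inE; split.
  move=> a u v; rewrite /pair_fun /= !topdual_linear scalerDr.
  by rewrite addrACA.
move=> z; apply: (@cvgD _ R^o).
  apply: continuous_comp; [exact: cvg_fst|exact: topdual_continuous].
apply: continuous_comp; [exact: cvg_snd|exact: topdual_continuous].
Qed.

Definition dual_pair (p : topdual X * topdual Y) : topdual (X * Y)%type :=
  TopDual (pair_funP p.1 p.2).

Lemma dual_pair_bij : bijective dual_pair.
Proof.
have m0 (V : tvsType R) (f : topdual V) : f 0 = 0.
  have := topdual_linear f (-1) 0 0.
  by rewrite scaler0 addr0 scaleN1r addNr.
have fl (h : topdual (X * Y)%type) :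
    (fun x => h (x, 0)) \in @topdual_pred R X.
  rewrite inE; split.
    move=> a u v; rewrite -topdual_linear; congr (h _).
    by apply/pair_equal_spec; split; rewrite //= scaler0 addr0.
  move=> x; apply: (@continuous_comp _ _ _ (fun x => (x, 0)) h).
    by apply: cvg_pair => /=; [exact: cvg_id|exact: cvg_cst].
  exact: topdual_continuous.
have fr (h : topdual (X * Y)%type) :
    (fun y => h (0, y)) \in @topdual_pred R Y.
  rewrite inE; split.
    move=> a u v; rewrite -topdual_linear; congr (h _).
    by apply/pair_equal_spec; split; rewrite //= scaler0 addr0.
  move=> y; apply: (@continuous_comp _ _ _ (fun y => (0, y)) h).
    by apply: cvg_pair => /=; [exact: cvg_cst|exact: cvg_id].
  exact: topdual_continuous.
exists (fun h => (TopDual (fl h), TopDual (fr h))).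
  move=> [f g]; congr pair; apply: val_inj; apply/funext => x /=.
    by rewrite /pair_fun /= m0 addr0.
  by rewrite /pair_fun /= m0 add0r.
move=> h; apply: val_inj; apply/funext => -[x y] /=; rewrite /pair_fun /=.
have := topdual_linear h 1 (x, 0) (0, y); rewrite !scale1r => <-.
by congr (h _); apply/pair_equal_spec; split; rewrite /= ?addr0 ?add0r.
Qed.

End dual_of_product.

Section polyhedral.
Context (R : realType) (Z : tvsType R).

Definition affine_subspace (L : set Z) :=
  forall x y (t : R), L x -> L y -> L ((1 - t) *: x + t *: y).

Definition halfspaces (p : nat) (zs : 'I_p -> topdual Z) (a : 'I_p -> R) :
  set Z := [set z | forall i, zs i z <= a i].

Definition gen_polyhedral_convex_set (D : set Z) :=
  exists (L : set Z) (p : nat) (zs : 'I_p -> topdual Z) (a : 'I_p -> R),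
    [/\ affine_subspace L, closed L & D = L `&` halfspaces zs a].

Definition polyhedral_convex_set (D : set Z) :=
  exists (p : nat) (zs : 'I_p -> topdual Z) (a : 'I_p -> R),
    D = halfspaces zs a.

Definition normal_cone (zbar : Z) (C : set Z) : set (topdual Z) :=
  [set zs | C zbar /\ forall z, C z -> zs (z - zbar) <= 0].

End polyhedral.

Section extended_real_functions.
Context (R : realType) (Z : tvsType R).
Implicit Type f : Z -> \bar R.

Definition effective_domain f : set Z := [set z | (f z < +oo)%E].

Definition proper_fun f := effective_domain f !=set0 /\ forall z, f z <> -oo%E.

(** [R^o] is [R] as a topological vector space over itself. *)
Definition epigraph f : set (Z * R^o) := [set p | (f p.1 <= (p.2 : R)%:E)%E].

Definition polyhedral_convex_fun f := polyhedral_convex_set (epigraph f).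

Definition gen_polyhedral_convex_fun f := gen_polyhedral_convex_set (epigraph f).

Definition singular_subdiff f (zbar : Z) : set (topdual Z) :=
  [set zs | f zbar \is a fin_num /\
    normal_cone (zbar, fine (f zbar)) (epigraph f) (dual_pair (zs, 0))].

End extended_real_functions.

Section set_valued_maps.
Context (R : realType) (X Y : tvsType R).
Implicit Type G : X -> set Y.

Definition gph G : set (X * Y) := [set z | G z.1 z.2].

Definition polyhedral_convex_map G := polyhedral_convex_set (gph G).

Definition gen_polyhedral_convex_map G := gen_polyhedral_convex_set (gph G).

Definition coderivative G (xbar : X) (ybar : Y) (ys : topdual Y) :
    set (topdual X) :=
  [set xs | normal_cone (xbar, ybar) (gph G) (dual_pair (xs, - ys))].

End set_valued_maps.

Section parametric_optimization.
Context (R : realType) (X Y : tvsType R).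
Variables (phi : X * Y -> \bar R) (G : X -> set Y).

(** [ereal_inf set0 = +oo] *)
Definition marginal (x : X) : \bar R := ereal_inf [set phi (x, y) | y in G x].

Definition solution_map (x : X) : set Y :=
  [set y | G x y /\ marginal x = phi (x, y)].

Definition set_add (V : zmodType) (A B : set V) : set V :=
  [set a + b | a in A & b in B].

(** The projection on [X^*] of the intersection of a set with [X^* * {0}]. *)
Definition dual_slice (S : set (topdual (X * Y)%type)) : set (topdual X) :=
  fst @` ((@dual_pair R X Y @^-1` S) `&` (setT `*` [set 0])).

Variables (xbar : X) (ybar : Y).

Definition A0_inf : set (topdual X) :=
  \bigcup_(p in @dual_pair R X Y @^-1` singular_subdiff phi (xbar, ybar))
    [set p.1 + u | u in coderivative G xbar ybar p.2].

Definition A_inf : set (topdual X) := closure A0_inf.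

Definition sum_inf : set (topdual (X * Y)%type) :=
  set_add (singular_subdiff phi (xbar, ybar))
    (normal_cone (xbar, ybar) (gph G)).

Definition B0_inf : set (topdual X) := dual_slice sum_inf.

Definition B_inf : set (topdual X) := dual_slice (closure sum_inf).

End parametric_optimization.

(* Main.v *)
(** The singular subdifferential of a function is the normal cone to its
    effective domain, and [dom mu] is the projection of [dom phi] intersected
    with [gph G]. Hence the singular subdifferential of [mu] at [xbar] is the
    slice of [N((xbar, ybar); dom phi `&` gph G)] by [X^* * {0}], and all the
    equalities follow from the exact sum rule
    [N(z; dom phi `&` C) = N(z; dom phi) + N(z; C)]: its left-hand side is
    weak-star closed. The sum rule is an instance of Farkas' lemma applied to
    finitely many linear functionals on a linear subspace (the direction of the
    affine part). A functional that agrees with the multipliers only on that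
    subspace is still normal to the set having the affine part, so the remainder
    is assigned to that set and no Hahn-Banach extension is needed. *)

Require Import Defs.
From HB Require Import structures.
From mathcomp Require Import all_boot all_order all_algebra.
From mathcomp Require Import all_classical all_reals all_analysis.
From mathcomp Require Import ring lra.
Import Order.TTheory GRing.Theory Num.Theory.
Import numFieldNormedType.Exports.
Local Open Scope classical_set_scope.
Local Open Scope ring_scope.

Set Implicit Arguments.
Unset Strict Implicit.
Unset Printing Implicit Defensive.

HB.instance Definition _ (R : realType) (Z : tvsType R) (f : topdual Z) :=
  GRing.isLinear.Build R Z R^o _ (topdual_fun f) (topdual_linear f).

(** * Farkas' lemma on a linear subspace *)

Lemma farkas (R : realFieldType) (V : lmodType R) (I : eqType) (s : seq I)
    (f : I -> {linear V -> R^o}) (g : {linear V -> R^o}) (S : set V) :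
  uniq s -> (forall a u v, S u -> S v -> S (a *: u + v)) ->
  (forall v, S v -> (forall i, i \in s -> f i v <= 0 :> R) -> g v <= 0 :> R) ->
  exists2 c : I -> R, forall i, 0 <= c i &
    forall v, S v -> g v = \sum_(i <- s) c i * f i v.
Proof.
elim: s S => [|j s IHs] S /=.
  move=> _ Slin Hg; exists (fun=> 0) => // v Sv; rewrite big_nil.
  have SN : S (- v).
    have -> : - v = (-2) *: v + v.
      rewrite -[X in _ + X]scale1r -scalerDl -scaleN1r.
      by congr (_ *: _); ring.
    exact: Slin.
  apply/eqP; rewrite eq_le; apply/andP; split; first exact: Hg.
  by rewrite -oppr_le0 -linearN; exact: Hg.
move=> /andP[js us] Slin Hg.
have [H|] := pselect (forall v, S v ->
    (forall i, i \in s -> f i v <= 0 :> R) -> g v <= 0 :> R).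
  have [c c0 Hc] := IHs S us Slin H.
  exists (fun i => if i == j then 0 else c i) => [i|v Sv].
    by case: ifP.
  rewrite big_cons eqxx mul0r add0r Hc //; apply: eq_big_seq => i si.
  by case: eqVneq => // ij; rewrite -ij si in js.
move=> /existsNP[v0 /not_implyP[Sv0 /not_implyP[fv0 /negP]]].
rewrite -ltNge => gv0.
have fj0 : 0 < (f j v0 : R).
  rewrite ltNge; apply/negP => fj; move: gv0; rewrite ltNge Hg //.
  by move=> i; rewrite inE => /orP[/eqP->//|]; exact: fv0.
pose S' := [set v | S v /\ f j v = 0].
have [|v [Sv fv] Hv|c c0 Hc] := IHs S' us.
- move=> a u v [Su fu] [Sv fv]; split; first exact: Slin.
  by rewrite linearP fu fv scaler0 addr0.
- by apply: Hg => // i; rewrite inE => /orP[/eqP->|]; [rewrite fv|exact: Hv].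
(* The only value for which the identity holds at [v0]. *)
pose d : R := (g v0 - \sum_(i <- s) c i * f i v0) / f j v0.
have d0 : 0 <= d.
  apply: divr_ge0; last exact: ltW.
  rewrite subr_ge0; apply: le_trans (ltW gv0).
  rewrite big_seq; apply: sumr_le0 => i si.
  by rewrite mulr_ge0_le0 ?c0 //; exact: fv0.
exists (fun i => if i == j then d else c i) => [i|v Sv].
  by case: ifP.
rewrite big_cons eqxx.
rewrite (eq_big_seq (fun i => c i * f i v)); last first.
  by move=> i si; case: eqVneq => // ij; rewrite -ij si in js.
(* Subtracting [t] times [v0] brings [v] into the kernel of [f j]. *)
pose t : R := f j v / f j v0.
have St : S' ((- t) *: v0 + v).
  split; first exact: Slin.
  by rewrite linearP /t /GRing.scale /= mulNr divfK ?addNr // gt_eqF.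
have E : - t * g v0 + g v =
    - t * (\sum_(i <- s) c i * f i v0) + \sum_(i <- s) c i * f i v.
  rewrite -[LHS](linearP g (- t) v0 v) Hc // mulr_sumr -big_split /=.
  by apply: eq_bigr => i _; rewrite linearP /GRing.scale /= mulrDr mulrCA.
have -> : d * f j v = t * (g v0 - \sum_(i <- s) c i * f i v0).
  by rewrite /d /t; ring.
by move: E; rewrite mulrBr; lra.
Qed.

(** * Normal cones and polyhedral sets *)

Section normal_cones.
Context (R : realType).
Implicit Type Z : tvsType R.

Lemma continuous_topdual_eval Z (z : Z) :
  continuous ((fun f => f z) : topdual Z -> R^o).
Proof.
move=> f.
apply: (@continuous_comp _ _ _ (@topdual_fun R Z : topdual Z -> {ptws Z -> R^o})
  (fun h : {ptws Z -> R^o} => h z)).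
  exact: initial_continuous.
exact: (@proj_continuous Z (fun=> R^o) z).
Qed.

(** Evaluations are weak-star continuous, and the cone is empty or an intersection of preimages of a
    closed half-line under them. *)
Lemma closed_normal_cone Z (z : Z) (C : set Z) : closed (normal_cone z C).
Proof.
have [Cz|nCz] := pselect (C z); last first.
  rewrite (_ : normal_cone z C = set0); first exact: closed0.
  by rewrite -subset0 => f [].
rewrite (_ : normal_cone z C =
  \bigcap_(w in C) ((fun f : topdual Z => f (w - z)) @^-1` [set x | x <= 0])).
  apply: closed_bigI => w _; apply: closed_comp; last exact: closed_le.
  by move=> f _; exact: continuous_topdual_eval.
by apply/seteqP; split => [f [_ fle]|f fle]; first exact: fle.
Qed.

Lemma topdual_sumE Z (I : finType) (P : pred I) (c : I -> R)
    (f : I -> topdual Z) (z : Z) :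
  (\sum_(i | P i) c i *: f i) z = \sum_(i | P i) c i * f i z.
Proof.
by apply: (big_ind2 (fun (h : topdual Z) x => h z = x)) => // h x h' y <- <-.
Qed.

Lemma normal_cone_active Z (z : Z) p (f : 'I_p -> topdual Z) (a : 'I_p -> R)
    (c : 'I_p -> R) : (forall i, 0 <= c i) -> forall w,
  halfspaces f a w -> \sum_(i | f i z == a i) c i * f i (w - z) <= 0.
Proof.
move=> c0 w Hw; apply: sumr_le0 => i /eqP fa.
by rewrite mulr_ge0_le0 // linearB /= fa subr_le0; exact: Hw.
Qed.

(** With [b] the slacks at a feasible point and [x] the values of the constraints on a direction,
    [t] is a step along it that stays feasible. *)
Lemma feasible_step (I : finType) (x b : I -> R) :
  (forall i, 0 <= b i) -> (forall i, b i = 0 -> x i <= 0) ->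
  exists2 t, 0 < t & forall i, t * x i <= b i.
Proof.
(* Division by 0 gives 0, so indices with [b i = 0] add nothing to [s]; the summand 1 keeps [s]
   positive. *)
move=> b0 xb; pose s := 1 + \sum_i `|x i| / b i.
have s0 : 0 < s.
  by rewrite ltr_pwDl // sumr_ge0 // => i _; rewrite divr_ge0.
exists s^-1; rewrite ?invr_gt0 // => i.
have [bi|bi] := eqVneq (b i) 0.
  by rewrite bi mulr_ge0_le0 ?xb // invr_ge0 ltW.
have bi0 : 0 < b i by rewrite lt_neqAle eq_sym bi b0.
rewrite mulrC ler_pdivrMr // mulrC -ler_pdivrMr //.
apply: le_trans (_ : `|x i| / b i <= _).
  by rewrite ler_pM2r ?invr_gt0 // ler_norm.
rewrite /s (bigD1 i) //= addrCA lerDl addr_ge0 // sumr_ge0 // => j _.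
by rewrite divr_ge0.
Qed.

(** The point reached is the midpoint of [z + 2a u] and [z + 2v], each on a line through [z] inside
    [L]. This is the stability that [farkas] asks of [S]. *)
Lemma affine_directions Z (L : set Z) (z : Z) : affine_subspace L -> L z ->
  forall a u v, L (z + u) -> L (z + v) -> L (z + (a *: u + v)).
Proof.
move=> Laff Lz.
have Ls (a : R) u : L (z + u) -> L (z + a *: u).
  move=> Lu; have := Laff _ _ a Lz Lu.
  by rewrite scalerBl scale1r scalerDr addrA subrK.
move=> a u v /(Ls (2 * a)) Lu /(Ls 2) Lv; have := Laff _ _ 2^-1 Lu Lv.
congr L.
have -> : (1 - 2^-1 : R) = 2^-1 by field.
rewrite -scalerDr addrACA !scalerDr !scalerA mulKf // mulVf // scale1r.
rewrite -scalerDl; have -> : (2^-1 + 2^-1 : R) = 1 by field.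
by rewrite scale1r.
Qed.

Lemma normal_cone_setI_polyhedral Z (z : Z) (D C : set Z) :
  polyhedral_convex_set D ->
  (exists (L : set Z) p (zs : 'I_p -> topdual Z) (a : 'I_p -> R),
    affine_subspace L /\ C = L `&` halfspaces zs a) ->
  normal_cone z (D `&` C) `<=` set_add (normal_cone z D) (normal_cone z C).
Proof.
move=> [p [f [a ->]]] [L [q [g [b [Laff ->]]]]] h [[Dz [Lz Cz]] Hh].
pose k (i : 'I_p + 'I_q) := match i with inl i => f i | inr j => g j end.
pose d (i : 'I_p + 'I_q) := match i with inl i => a i | inr j => b j end.
have kz i : k i z <= d i by case: i => i; [exact: Dz|exact: Cz].
have [v Lv kv|c c0 Hc] := @farkas R Z _ (enum [pred i | k i z == d i]) k h
    [set v | L (z + v)] (enum_uniq _) (affine_directions Laff Lz).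
  (* Hypothesis of [farkas]: a direction of [L] respecting the active constraints can be followed a
     little inside both sets, so [h] is nonpositive on it. *)
  have [i|i di|t t0 Ht] :=
    @feasible_step _ (fun i => k i v) (fun i => d i - k i z).
  - by rewrite subr_ge0.
  - by apply: kv; rewrite mem_enum inE eq_sym -subr_eq0 di.
  have kt i : k i (t *: v + z) <= d i.
    by rewrite linearD linearZ /= -lerBrDr; exact: Ht.
  have := Hh (t *: v + z); rewrite addrK linearZ pmulr_rle0 //; apply.
  split; first by move=> i; exact: (kt (inl i)).
  split; last by move=> i; exact: (kt (inr i)).
  by rewrite addrC -[t *: v]addr0; apply: affine_directions; rewrite ?addr0.
(* [h1] takes the active constraints of [D]; on directions of [L], [h - h1] is the combination of
   those of [C]. *)
pose h1 := \sum_(i | f i z == a i) c (inl i) *: f i.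
have h1N : normal_cone z (halfspaces f a) h1.
  split=> // w Dw; rewrite topdual_sumE.
  exact: (normal_cone_active z (fun i => c0 (inl i)) Dw).
exists h1 => //; exists (h - h1); last by rewrite addrC subrK.
split=> // w [Lw Cw].
have := Hc (w - z); rewrite /= [z + _]addrC subrK => /(_ Lw).
rewrite big_enum /= big_sumType /= => E.
rewrite -[leLHS]/(h (w - z) - h1 (w - z)) E topdual_sumE addrAC subrr add0r.
exact: (normal_cone_active z (fun i => c0 (inr i)) Cw).
Qed.

(** The functional [(h, 0)] ignores heights, and every point of the domain has a point of the
    epigraph above it. *)
Lemma singular_subdiffE Z (f : Z -> \bar R) (z : Z) : f z \is a fin_num ->
  singular_subdiff f z = normal_cone z (effective_domain f).
Proof.
move=> fz; apply/seteqP; split => h.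
  move=> [_ [_ Hh]]; split=> [|w fw].
    by rewrite /effective_domain /= ltey_eq fz.
  have [r Hr] : exists r : R, (f w <= r%:E)%E.
    move: fw; rewrite /effective_domain /=; case: (f w) => // [r _|_].
      by exists r.
    (* Where [f] is [-oo], any real height will do. *)
    by exists 0; rewrite leNye.
  by have := Hh (w, r) Hr; rewrite /= /pair_fun /= addr0.
move=> [_ Hh]; split=> //; split=> [|[w r] fw].
  by rewrite /epigraph /= fineK.
rewrite /= /pair_fun /= addr0; apply: Hh.
by rewrite /effective_domain /=; apply: le_lt_trans fw (ltry _).
Qed.

End normal_cones.

(** * Functionals and cylinders in a product *)

Section product_space.
Context (R : realType) (X Y : tvsType R).

Lemma dual_pairD (p q : topdual X * topdual Y) :
  dual_pair (p + q) = dual_pair p + dual_pair q.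
Proof.
by apply: val_inj; apply/funext => z; rewrite /= /pair_fun /= addrACA.
Qed.

(** The cylinder contains all translates of [p] along [Y], so the second component of a normal is
    nonpositive on [Y], hence zero. *)
Lemma normal_cone_snd_invariant (p : X * Y) (C : set X) :
  normal_cone p (fst @^-1` C) =
  (fun h => dual_pair (h, 0)) @` normal_cone p.1 C.
Proof.
apply/seteqP; split => [_h|_ [h [Cp Hh] <-]]; last first.
  by split=> // w Cw; rewrite /= /pair_fun /= addr0; exact: Hh.
have [dual dualK pairK] := dual_pair_bij X Y.
rewrite -(pairK _h); case: (dual _h) => h g [Cp Hh].
have g0 : g = 0.
  apply: val_inj; apply/funext => y /=.
  have gle y' : g y' <= 0 :> R.
    have := Hh ((0, y') + p); rewrite addrK /= /pair_fun /= linear0 !add0r.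
    exact.
  by apply/eqP; rewrite eq_le gle -oppr_le0 -linearN gle.
exists h; last by rewrite g0.
split=> // x Cx; have := Hh (x, p.2) Cx.
by rewrite /= /pair_fun /= subrr linear0 addr0.
Qed.

Lemma affine_subspace_fst (L : set X) :
  affine_subspace L -> affine_subspace ((fst : X * Y -> X) @^-1` L).
Proof. by move=> Laff x y t; exact: Laff. Qed.

Lemma halfspaces_fst n (f : 'I_n -> topdual X) (a : 'I_n -> R) :
  (fst : X * Y -> X) @^-1` halfspaces f a =
  halfspaces (fun i => dual_pair (f i, 0)) a.
Proof.
by apply/seteqP; split => z Hz i; have := Hz i; rewrite /= /pair_fun /= addr0.
Qed.

End product_space.

(** * The exact sum rule *)

Section sum_rule.
Context (R : realType) (Z : tvsType R).

(* The decomposition is performed in [Z * R^o], between the epigraph of [f] and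
   the cylinder over [C]: this avoids having to show that [effective_domain f],
   a projection of the epigraph, is polyhedral. *)
Lemma normal_cone_domI (f : Z -> \bar R) (C : set Z) (z : Z) :
  polyhedral_convex_fun f /\ gen_polyhedral_convex_set C \/
    gen_polyhedral_convex_fun f /\ polyhedral_convex_set C ->
  f z \is a fin_num -> C z ->
  normal_cone z (effective_domain f `&` C) =
  set_add (singular_subdiff f z) (normal_cone z C).
Proof.
move=> cond fz Cz; rewrite singular_subdiffE //.
apply/seteqP; split => [h [[domz _] Hh]|]; last first.
  move=> _ [h1 [domz H1] [h2 [_ H2] <-]].
  split=> // w [domw Cw].
  by rewrite -[leLHS]/(h1 (w - z) + h2 (w - z)) -(addr0 0) lerD ?H1 ?H2.
pose C' := (fst : Z * R^o -> Z) @^-1` C.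
pose w : Z * R^o := (z, fine (f z)).
have hN : normal_cone w (epigraph f `&` C') (dual_pair (h, 0)).
  split; first by split => //; rewrite /epigraph /= fineK.
  move=> [v r] [fv Cv]; rewrite /= /pair_fun /= addr0; apply: Hh; split => //.
  exact: le_lt_trans fv (ltry _).
have [h1 H1 [h2 H2 h12]] :
    set_add (normal_cone w (epigraph f)) (normal_cone w C') (dual_pair (h, 0)).
  case: cond => -[].
    move=> polyf [L [p [g [a [Laff _ CE]]]]].
    apply: normal_cone_setI_polyhedral hN => //.
    exists (fst @^-1` L), p, (fun i => dual_pair (g i, 0)), a.
    split; first exact: affine_subspace_fst.
    by rewrite -halfspaces_fst -preimage_setI -CE.
  (* Here the cylinder is the polyhedral set, so the two sets exchange roles. *)
  move=> [L [p [g [a [Laff _ fE]]]]] [q [k [b CE]]].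
  move: hN; rewrite setIC => /normal_cone_setI_polyhedral[||h2 H2 [h1 H1 <-]].
  - exists q, (fun i => dual_pair (k i, 0)), b.
    by rewrite -halfspaces_fst -CE.
  - by exists L, p, g, a.
  - by exists h1 => //; exists h2 => //; rewrite addrC.
(* The normal to the cylinder has no height component, so neither has the other summand [h1], which
   therefore is a singular subgradient. *)
move: H2; rewrite normal_cone_snd_invariant => -[h2' H2' h2E].
exists (h - h2'); last by exists h2' => //; rewrite subrK.
rewrite -singular_subdiffE//; split => //.
suff -> : dual_pair (h - h2', 0) = h1 by [].
apply: (addIr h2); rewrite h12 -h2E -dual_pairD; congr dual_pair.
by apply/pair_equal_spec; rewrite /= subrK addr0.
Qed.

End sum_rule.

(** * The marginal function *)

Section marginal_function.
Context (R : realType) (X Y : tvsType R).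
Context (phi : X * Y -> \bar R) (G : X -> set Y).

Lemma effective_domain_marginal : effective_domain (marginal phi G) =
  fst @` (effective_domain phi `&` gph G).
Proof.
apply/seteqP; split => [x|_ [[x y] [domxy Gxy] <-]].
  move=> /ereal_inf_lt[_ [y Gxy <-] phixy].
  by exists (x, y).
by apply: le_lt_trans domxy; apply: ereal_inf_lbound; exists y.
Qed.

Lemma normal_cone_fst_image (S : set (X * Y)) (p : X * Y) : S p ->
  normal_cone p.1 (fst @` S) = dual_slice (normal_cone p S).
Proof.
move=> Sp; apply/seteqP; split => [h [_ Hh]|_ [[h g] [Hg [_ /= g0]] <-]].
  exists (h, 0) => //; split => //; split => // w Sw.
  by rewrite /= /pair_fun /= addr0; apply: Hh; exists w.
move: Hg; rewrite g0 => -[_ Hh].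
split; first by exists p.
by move=> _ [w Sw <-]; have := Hh w Sw; rewrite /= /pair_fun /= addr0.
Qed.

Lemma A0_infE (x : X) (y : Y) : A0_inf phi G x y = B0_inf phi G x y.
Proof.
have [dual dualK pairK] := dual_pair_bij X Y.
apply/seteqP; split => [_ [p phip [u Gu <-]]|].
  exists (p.1 + u, 0) => //; split => //.
  exists (dual_pair p) => //; exists (dual_pair (u, - p.2)) => //.
  rewrite -dual_pairD; congr dual_pair.
  by apply/pair_equal_spec; rewrite /= subrr.
move=> _ [[h g] [Hg [_ /= g0]] <-].
move: Hg; rewrite g0 => -[h1 H1 [h2 H2 h12]].
exists (dual h1); first by rewrite /= pairK.
exists (h - (dual h1).1); last by rewrite addrC subrK.
rewrite /coderivative /=.
suff -> : dual_pair (h - (dual h1).1, - (dual h1).2) = h2 by [].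
apply: (addrI h1); rewrite h12 -{1}(pairK h1) -dual_pairD; congr dual_pair.
by apply/pair_equal_spec; rewrite /= subrr addrC subrK.
Qed.

End marginal_function.

Theorem theorem5p2 (R : realType) (X Y : tvsType R)
    (hausX : hausdorff_space X) (hausY : hausdorff_space Y)
    (phi : X * Y -> \bar R) (G : X -> set Y)
    (cond : (proper_fun phi /\ polyhedral_convex_fun phi /\
               gen_polyhedral_convex_map G)
            \/ (proper_fun phi /\ gen_polyhedral_convex_fun phi /\
               polyhedral_convex_map G))
    (xbar : X) (mu_fin : marginal phi G xbar \is a fin_num)
    (ybar : Y) (ybar_sol : solution_map phi G xbar ybar) :
  [/\ singular_subdiff (marginal phi G) xbar = A0_inf phi G xbar ybar,
      A0_inf phi G xbar ybar = A_inf phi G xbar ybar,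
      A_inf phi G xbar ybar = B0_inf phi G xbar ybar
    & B0_inf phi G xbar ybar = B_inf phi G xbar ybar].
Proof.
have [Gxy muE] := ybar_sol.
have phi_fin : phi (xbar, ybar) \is a fin_num by rewrite -muE.
(* By the sum rule the sum is a normal cone, hence weak-star closed. *)
have sumE : sum_inf phi G xbar ybar =
    normal_cone (xbar, ybar) (effective_domain phi `&` gph G).
  rewrite normal_cone_domI //.
  by case: cond => -[_ ?]; [left|right].
have muB0 : singular_subdiff (marginal phi G) xbar = B0_inf phi G xbar ybar.
  rewrite singular_subdiffE // effective_domain_marginal.
  rewrite (@normal_cone_fst_image _ _ _ _ (xbar, ybar)) ?/B0_inf ?sumE //.
  by split=> //; rewrite /effective_domain /= ltey_eq phi_fin.
(* [A0_inf] is the normal cone to the domain of the marginal function, so its closure adds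
   nothing. *)
have A0A : A_inf phi G xbar ybar = A0_inf phi G xbar ybar.
  rewrite /A_inf -(closure_id _).1 // A0_infE -muB0 singular_subdiffE //.
  exact: closed_normal_cone.
split; rewrite ?A0A ?A0_infE //.
rewrite /B_inf -(closure_id _).1 // sumE; exact: closed_normal_cone.
Qed.
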